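(* Let $\varphi:\mathbb R\to\mathbb R$ be continuous such that $\lim_{x\to-\infty}\varphi(x)$ and $\lim_{x\to\infty}\varphi(x)$ exist and are finite and distinct. Let $h:\mathbb R\to\mathbb R$ be a continuous function satisfying $h(x)=0$ for $x\le0$ and $h(x)=1$ for $x\ge1$, and define $f:\mathbb R^2\to\mathbb R$ by $f(x,y):=h(x)h(y)$ (which is an element of $\overline{\mathcal N_\varphi^2(\mathbb R^2)}$). Then $$\sup_{v\in\mathbb R^2}|f(v)-g(v)|\ge\frac14\qquad\text{for all }g\in\mathcal N_\varphi^1(\mathbb R^2).$$
   Context: For a function $\varphi:\mathbb R\to\mathbb R$ and $n\in\{1,2,\ldots\}$ define the real vector spaces of functions $\mathbb R^n\to\mathbb R$ $$\mathcal N_\varphi^1(\mathbb R^n):=\operatorname{span}\{x\mapsto\varphi(a\cdot x+b)\mid a\in\mathbb R^n,\ b\in\mathbb R\},$$ $$\mathcal N_\varphi^2(\mathbb R^n):=\operatorname{span}\{x\mapsto\varphi(f(x)+b)\mid f\in\mathcal N_\varphi^{1}(\mathbb R^n),\ b\in\mathbb R\},$$ where span is the $\mathbb R$-linear span and $a\cdot x$ is the Euclidean inner product. Overline denotes uniform closure (closure with respect to the supremum norm over $\mathbb R^n$). *)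

(* Defs.v *)
From mathcomp Require Import all_boot all_order all_algebra.
From mathcomp Require Import all_classical all_reals all_analysis.

Set Implicit Arguments.
Unset Strict Implicit.
Unset Printing Implicit Defensive.

Import Order.TTheory GRing.Theory Num.Theory.
Import numFieldNormedType.Exports.

Local Open Scope classical_set_scope.
Local Open Scope ring_scope.

(* [vector.span] only handles finite sequences in a finite-dimensional space;
   here [A] may be infinite and [V] is any module, e.g. a space of functions. *)
Definition linspan (R : nzRingType) (V : lmodType R) (A : set V) : set V :=
  [set v | exists (k : nat) (c : 'I_k -> R) (s : 'I_k -> V),
     (forall i, A (s i)) /\ v = \sum_(i < k) c i *: s i].

Definition dotp (R : nzRingType) (n : nat) (a x : 'rV[R]_n) : R :=
  \sum_(i < n) a ord0 i * x ord0 i.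

Definition N1 (R : realType) (phi : R -> R) (n : nat) : set ('rV[R]_n -> R) :=
  linspan [set u : 'rV[R]_n -> R | exists (a : 'rV[R]_n) (b : R),
     u = fun x => phi (dotp a x + b)].

Definition N2 (R : realType) (phi : R -> R) (n : nat) : set ('rV[R]_n -> R) :=
  linspan [set u : 'rV[R]_n -> R | exists (f : 'rV[R]_n -> R) (b : R),
     N1 phi f /\ u = fun x => phi (f x + b)].

(* The cast selects the topology of uniform convergence on all of [T]
   (instead of that of pointwise convergence). *)
Definition uniform_closure (R : realType) (T : choiceType) (A : set (T -> R)) :
    set (T -> R) :=
  closure (A : set {uniform T -> R}).

(* Main.v *)
Require Import Defs.
From mathcomp Require Import all_boot all_order all_algebra.
From mathcomp Require Import all_classical all_reals all_analysis.
From mathcomp Require Import ring lra.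

Import Order.TTheory GRing.Theory Num.Theory.
Import numFieldNormedType.Exports.

Local Open Scope classical_set_scope.
Local Open Scope ring_scope.

(* Lower bound: along a line [t u], the sum [g (t u) + g (- t u)] of a shallow
   network [g] tends, as [t] tends to infinity, to a constant that is the same for
   all directions [u] not orthogonal to any nonzero weight of [g], because
   opposite directions together see both limits of [phi].  For [f] the sum is
   eventually 1 if [u] points into the first quadrant and 0 if it points into the
   fourth, so the uniform error [s] satisfies [1 <= 4 s].

   Membership: every continuous function on the line with limits at both infinities
   is uniformly approximated by combinations of [x |-> phi (a x + b)] (steep
   sigmoids summing to a staircase).  Hence [h x + h y] and [h x - h y] are
   approximated by one layer, and the truncated square, applied through a second
   layer, gives [h x * h y] by polarization. *)

(** * Linear spans and uniform approximation by their elements *)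

Definition span_approx {R : realType} {T : Type} (A : set (T -> R)) (f : T -> R) : Prop :=
  forall e : R, 0 < e -> exists2 g, linspan A g & forall v, `|f v - g v| <= e.

Lemma linspan_incl (R : nzRingType) (V : lmodType R) (A : set V) (v : V) :
  A v -> linspan A v.
Proof.
move=> Av; exists 1%N, (fun=> 1), (fun=> v); split=> //.
by rewrite big_ord1 scale1r.
Qed.

Lemma linspan0 (R : nzRingType) (V : lmodType R) (A : set V) : linspan A 0.
Proof.
by exists 0%N, (fun=> 0), (fun=> 0); split; [case|rewrite big_ord0].
Qed.

Lemma linspanD (R : nzRingType) (V : lmodType R) (A : set V) (u v : V) :
  linspan A u -> linspan A v -> linspan A (u + v).
Proof.
move=> [k [c [s [As ->]]]] [l [d [t [At ->]]]].
exists (k + l)%N, (fun i : 'I_(k + l) => match fintype.split i with inl j => c j | inr j => d j end),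
  (fun i : 'I_(k + l) => match fintype.split i with inl j => s j | inr j => t j end).
split=> [i|]; first by case: (fintype.split i).
rewrite big_split_ord; congr (_ + _); apply: eq_bigr => i _.
  by case: split_ordP => j; [move=> /lshift_inj->|move/eqP; rewrite eq_lrshift].
by case: split_ordP => j; [move/eqP; rewrite eq_rlshift|move=> /rshift_inj->].
Qed.

Lemma linspanZ (R : nzRingType) (V : lmodType R) (A : set V) (a : R) (v : V) :
  linspan A v -> linspan A (a *: v).
Proof.
move=> [k [c [s [As ->]]]]; exists k, (fun i => a * c i), s; split=> //.
by rewrite scaler_sumr; apply: eq_bigr => i _; rewrite scalerA.
Qed.

Lemma linspan_sum (R : nzRingType) (V : lmodType R) (A : set V) (I : Type)
    (r : seq I) (F : I -> V) :
  (forall i, linspan A (F i)) -> linspan A (\sum_(i <- r) F i).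
Proof.
move=> AF; apply: (big_ind (linspan A)) => //; first exact: linspan0.
by move=> *; apply: linspanD.
Qed.

(** Precomposition with [F] is linear, so generators suffice. It is used with [F] a coordinate of
    the input and with [F] a first-layer function. *)
Lemma linspan_comp (R : realType) (S T : Type) (A : set (S -> R))
    (B : set (T -> R)) (F : T -> S) :
  (forall u, A u -> linspan B (u \o F)) ->
  forall g, linspan A g -> linspan B (g \o F).
Proof.
move=> AB g [k [c [s [As ->]]]].
have -> : (\sum_(i < k) c i *: s i) \o F = \sum_(i < k) c i *: (s i \o F).
  by apply/funext => x /=; rewrite !fct_sumE.
by apply: linspan_sum => i; apply/linspanZ/AB.
Qed.

Lemma span_approxD (R : realType) (T : Type) (A : set (T -> R)) (f g : T -> R) :
  span_approx A f -> span_approx A g -> span_approx A (f + g).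
Proof.
move=> Af Ag e e0; have e20 : 0 < e / 2 by rewrite divr_gt0.
have [f' Af' ff'] := Af _ e20; have [g' Ag' gg'] := Ag _ e20.
exists (f' + g'); first exact: linspanD.
move=> v; rewrite [e]splitr [X in `|X|](_ : _ = (f v - f' v) + (g v - g' v)).
  by rewrite (le_trans (ler_normD _ _)) ?lerD.
by rewrite !fctE; ring.
Qed.

Lemma span_approxZ (R : realType) (T : Type) (A : set (T -> R)) (a : R)
    (f : T -> R) :
  span_approx A f -> span_approx A (a *: f).
Proof.
move=> Af e e0; have e10 : 0 < e / (`|a| + 1) by rewrite divr_gt0 ?ltr_wpDl.
have [f' Af' ff'] := Af _ e10.
exists (a *: f'); first exact: linspanZ.
move=> v; rewrite -[_ - _]/(a * f v - a * f' v) -mulrBr normrM.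
apply: le_trans (_ : (`|a| + 1) * (e / (`|a| + 1)) <= _).
  by rewrite ler_pM // lerDl.
by rewrite mulrC divfK // gt_eqF ?ltr_wpDl.
Qed.

(** * The dot product on row vectors *)

Lemma dotpZr (R : comNzRingType) (n : nat) (c : R) (a u : 'rV[R]_n) :
  dotp a (c *: u) = c * dotp a u.
Proof.
by rewrite /dotp mulr_sumr; apply: eq_bigr => i _; rewrite mxE; ring.
Qed.

Lemma dotpZl (R : comNzRingType) (n : nat) (c : R) (a u : 'rV[R]_n) :
  dotp (c *: a) u = c * dotp a u.
Proof.
by rewrite /dotp mulr_sumr; apply: eq_bigr => i _; rewrite mxE; ring.
Qed.

Lemma dotp_delta (R : comNzRingType) (n : nat) (i : 'I_n) (v : 'rV[R]_n) :
  dotp (delta_mx ord0 i) v = v ord0 i.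
Proof.
rewrite /dotp (bigD1 i) //= big1 ?addr0; first by rewrite mxE !eqxx mul1r.
by move=> j /negPf ji; rewrite mxE ji andbF mul0r.
Qed.

(** * Real functions with finite limits at both infinities *)

Lemma ler_dist_half (R : realType) (x y z e : R) :
  `|x - z| <= e / 2 -> `|y - z| <= e / 2 -> `|x - y| <= e.
Proof.
move=> xz yz; rewrite [e]splitr (le_trans (ler_distD z _ _)) //.
by rewrite lerD // distrC.
Qed.

Lemma cvg_pinfty_dist (R : realType) (F : R -> R) (l e : R) :
  F x @[x --> +oo] --> l -> 0 < e ->
  exists2 M : R, 0 < M & forall x, M <= x -> `|F x - l| <= e.
Proof.
move=> /cvgrPdist_le Fl e0; have [M [_ HM]] := Fl _ e0.
exists (`|M| + 1) => [|x Mx]; first by rewrite ltr_wpDl.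
by rewrite distrC; apply/HM/(lt_le_trans _ Mx); rewrite (le_lt_trans (ler_norm _)) ?ltrDl.
Qed.

Lemma cvg_ninfty_dist (R : realType) (F : R -> R) (l e : R) :
  F x @[x --> -oo] --> l -> 0 < e ->
  exists2 M : R, 0 < M & forall x, x <= - M -> `|F x - l| <= e.
Proof.
move=> /cvgNy_compNP Fl e0; have [M M0 HM] := @cvg_pinfty_dist _ _ _ _ Fl e0.
exists M => // x xM; rewrite -[x]opprK; apply: HM; lra.
Qed.

Lemma cvg_infty_dist (R : realType) (F : R -> R) (lm lp e : R) :
  F x @[x --> -oo] --> lm -> F x @[x --> +oo] --> lp -> 0 < e ->
  exists2 M : R, 0 < M &
    (forall x, x <= - M -> `|F x - lm| <= e) /\
    (forall x, M <= x -> `|F x - lp| <= e).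
Proof.
move=> /cvg_ninfty_dist Fm /cvg_pinfty_dist Fp e0.
have [M M0 HM] := Fm _ e0; have [N N0 HN] := Fp _ e0.
exists (M + N); first exact: addr_gt0.
by split=> x xM; [apply: HM|apply: HN]; lra.
Qed.

Lemma cvg_infty_bounded (R : realType) (F : R -> R) (lm lp : R) :
  continuous F -> F x @[x --> -oo] --> lm -> F x @[x --> +oo] --> lp ->
  exists2 B : R, 0 < B & forall x, `|F x| <= B.
Proof.
move=> cF Fm Fp.
have [M M0 [HM HP]] := @cvg_infty_dist _ _ _ _ _ Fm Fp ltr01.
have cK : compact (F @` `[- M, M]).
  by apply: continuous_compact (segment_compact (a:=- M) (b:=M)); apply: continuous_subspaceT.
have [N [_ HN]] := compact_bounded cK.
have n0 (y : R) := normr_ge0 y.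
have := n0 N; have := n0 lm; have := n0 lp => ? ? ?.
exists (`|N| + 1 + (`|lm| + 1) + (`|lp| + 1)) => [|x]; first by lra.
have [xM|Mx] := leP x (- M).
  have := HM x xM; have := ler_normD (F x - lm) lm; rewrite subrK; lra.
have [Mx'|xM] := leP M x.
  have := HP x Mx'; have := ler_normD (F x - lp) lp; rewrite subrK; lra.
have FN : `|F x| <= `|N| + 1.
  apply: HN; first by rewrite (le_lt_trans (ler_norm _)) ?ltrDl.
  by exists x => //=; rewrite in_itv /= !ltW.
have := n0 (F x); lra.
Qed.

(** Heine-Cantor on a segment [[- M, M]], combined with closeness to the limits on the two tails. *)
Lemma cvg_infty_unif_cont (R : realType) (F : R -> R) (lm lp e : R) :
  continuous F -> F x @[x --> -oo] --> lm -> F x @[x --> +oo] --> lp -> 0 < e ->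
  exists2 d : R, 0 < d & forall x y, `|x - y| < d -> `|F x - F y| <= e.
Proof.
move=> cF Fm Fp e0; have e20 : 0 < e / 2 by rewrite divr_gt0.
have [M M0 [HM HP]] := @cvg_infty_dist _ _ _ _ _ Fm Fp e20.
have /compact_near_coveringP cK := segment_compact (a:=- M) (b:=M).
have := cK _ 0^'+ (fun d x => forall y, `|x - y| < d -> `|F x - F y| <= e) _.
case.
  move=> x _; have /cvgrPdist_le /(_ _ e20) /nbhs_ballP [r /= r0 Hr] := cF x.
  have r20 : 0 < r / 2 by rewrite divr_gt0.
  exists (ball x (r / 2), [set d | d < r / 2]).
    by split; [exact: nbhsx_ballx|exact: nbhs_right_lt].
  move=> [x' d] /= [xx' dr] y x'y.
  have x'x : ball x r x' by apply: le_ball xx'; lra.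
  have xy : ball x r y.
    move: xx'; rewrite /ball /= => xx'.
    rewrite [r]splitr -(subrK x' x) -addrA (le_lt_trans (ler_normD _ _))//.
    by rewrite ltrD // (lt_trans x'y).
  have := Hr _ x'x; have := Hr _ xy => /= h1 h2.
  by apply: (@ler_dist_half _ _ _ (F x)); rewrite distrC.
(* Points on opposite tails are more than [2 * M] apart, so with [d <= M] two points outside the
   segment at distance below [d] share a tail. *)
move=> d0 /= d00 Hd; set d := Num.min (d0 / 2) M.
have d_gt0 : 0 < d by rewrite lt_min M0 divr_gt0.
have dM : d <= M by rewrite ge_min lexx orbT.
have Kd x y : - M <= x <= M -> `|x - y| < d -> `|F x - F y| <= e.
  move=> xM xy; apply: (Hd (d0 / 2)) => //=.
  - by rewrite sub0r normrN gtr0_norm ?divr_gt0 // ltr_pdivrMr // ltr_pMr // ltr1n.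
  - by rewrite divr_gt0.
  - by rewrite (lt_le_trans xy) // ge_min lexx.
exists d => // x y xy.
have [xM|Mx] := boolP (- M <= x <= M); first exact: Kd.
have [yM|My] := boolP (- M <= y <= M).
  by rewrite distrC Kd // distrC.
move: Mx My xy; rewrite !negb_and -!ltNge ltr_norml => /orP[] xM /orP[] yM /andP[? ?].
- by apply: (@ler_dist_half _ _ _ lm); apply: HM; lra.
- by lra.
- by lra.
- by apply: (@ler_dist_half _ _ _ lp); apply: HP; lra.
Qed.

(** * One-variable approximation by steep sigmoids *)

Lemma step_function_dist (R : realType) (H : R -> R) (t : nat -> R) (e : R)
    (n : nat) :
  (forall i, t i <= t i.+1) ->
  (forall x, x <= t 0%N -> `|H x - H (t 0%N)| <= e) ->
  (forall i x, t i <= x <= t i.+1 -> `|H x - H (t i)| <= e) ->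
  (forall x, t n <= x -> `|H x - H (t n)| <= e) ->
  forall x, `|H x - (H (t 0%N) +
    \sum_(i < n) (H (t i.+1) - H (t i)) * (t i.+1 <= x)%R%:R)| <= e.
Proof.
move=> tS H0 Hi Hn x.
pose S m := H (t 0%N) + \sum_(i < m) (H (t i.+1) - H (t i)) * (t i.+1 <= x)%R%:R.
(* From [t n] on, every jump is switched on and the sum telescopes to [H (t n)]; before it the last
   jump is still off, which leaves the shorter sum. *)
have [Slt Sge] : (x < t n -> `|H x - S n| <= e) /\ (t n <= x -> S n = H (t n)).
  elim: n {Hn} => [|n [IHlt IHge]].
    by rewrite /S big_ord0 addr0; split=> // /ltW; apply: H0.
  rewrite {1 2}/S !big_ord_recr /= addrA -/(S n); split.
    move=> xt; rewrite [t n.+1 <= x]leNgt xt /= mulr0 addr0.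
    have [tx|tx] := ltP x (t n); first exact: IHlt.
    by rewrite IHge // Hi // tx ltW.
  by move=> tx; rewrite tx mulr1 IHge ?(le_trans (tS n)) // addrC subrK.
by have [/Slt//|tx] := ltP x (t n); rewrite -/(S n) Sge // Hn.
Qed.

(** Serves to bound the total error of the sigmoids: the single one in transition costs at most [C],
    each of the others at most [eta]. *)
Lemma ler_sum_one_large (R : realType) (n : nat) (w : 'I_n -> R) (C eta : R) :
  0 <= eta -> 0 <= C -> (forall i, w i <= C) ->
  (forall i j, eta < w i -> eta < w j -> i = j) ->
  \sum_(i < n) w i <= C + n%:R * eta.
Proof.
move=> eta0 C0 wC wu.
have sE (P : pred 'I_n) : \sum_(i < n | P i) eta <= n%:R * eta.
  rewrite sumr_const mulr_natl ler_wpMn2l //.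
  by rewrite -[leqRHS]card_ord max_card.
have [j wj|small] := pickP (fun i => eta < w i).
  rewrite (bigD1 j) //= lerD //; apply: le_trans (sE (fun i => i != j)).
  apply: ler_sum => i ij; rewrite leNgt; apply: contraNN ij => wi.
  by rewrite (wu i j wi wj).
apply: (@le_trans _ _ (\sum_(i < n) eta)); last by rewrite (le_trans (sE _)) ?lerDr.
by apply: ler_sum => i _; rewrite leNgt small.
Qed.

Definition affine_dilates {R : realType} (phi : R -> R) : set (R -> R) :=
  [set u | exists a b : R, u = fun x => phi (a * x + b)].

(** With weight 0 a unit is the constant [phi b], and distinct limits prevent [phi] from vanishing
    identically. *)
Lemma linspan_cst (R : realType) (phi : R -> R) (lm lp c : R) :
  phi x @[x --> -oo] --> lm -> phi x @[x --> +oo] --> lp -> lm <> lp ->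
  linspan (affine_dilates phi) (fun=> c).
Proof.
move=> pm pp lml.
have [b pb0] : exists b, phi b != 0.
  apply: contrapT => /forallNP p0; apply: lml.
  have phi0 : phi = fun=> 0.
    by apply/funext => b; apply/eqP; apply: contrapT => /negP; apply: p0.
  move: pm pp; rewrite phi0 => pm pp.
  have hausR := @norm_hausdorff R R^o.
  exact: etrans (cvg_unique hausR pm (cvg_cst 0)) (esym (cvg_unique hausR pp (cvg_cst 0))).
have -> : (fun=> c) = (c / phi b) *: (fun x : R => phi (0 * x + b)).
  by apply/funext => x; rewrite -[RHS]/(_ * _) mul0r add0r divfK.
by apply/linspanZ/linspan_incl; exists 0, b.
Qed.

(* Approximate [F] by a step function with small jumps, then replace each jump
   by a steep sigmoid: at every point at most one of them is off its limits. *)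
Lemma sigmoid_approx (R : realType) (s : R -> R) (F : R -> R) (lm lp : R) :
  continuous s -> s x @[x --> -oo] --> (0 : R) -> s x @[x --> +oo] --> (1 : R) ->
  continuous F -> F x @[x --> -oo] --> lm -> F x @[x --> +oo] --> lp ->
  span_approx (affine_dilates s) F.
Proof.
move=> cs sm sp cF Fm Fp e0 e00.
have [B B0 sB] := @cvg_infty_bounded _ _ _ _ cs sm sp.
(* The staircase costs [e]. The sigmoids cost [e] times [B + 1] for the one in transition, plus [e]
   for all the others: [e * (B + 3)] in total. *)
pose e := e0 / (B + 3).
have e_gt0 : 0 < e by rewrite divr_gt0 // addr_gt0.
have [d d0 Fd] := @cvg_infty_unif_cont _ _ _ _ _ cF Fm Fp e_gt0.
have e20 : 0 < e / 2 by rewrite divr_gt0.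
have [K K0 [FK FK']] := @cvg_infty_dist _ _ _ _ _ Fm Fp e20.
(* The mesh lies strictly below [d], as [Fd] demands; [n] such steps lead from [- K] past [K], so
   that both ends of the grid lie in the tails of [F]. *)
pose dl := d / 2; have dl0 : 0 < dl by rewrite divr_gt0.
have dld : dl < d by rewrite /dl; lra.
pose n := Num.bound (2 * K / dl).
have nK : 2 * K < n%:R * dl.
  by rewrite -ltr_pdivrMr // archi_boundP // divr_ge0 ?mulr_ge0 // ltW.
pose t (i : nat) := - K + i%:R * dl.
have tS i : t i.+1 = t i + dl by rewrite /t -natr1; ring.
pose eta : R := n.+1%:R^-1.
have eta0 : 0 < eta by rewrite invr_gt0.
have neta : n%:R * eta <= 1 by rewrite ler_pdivrMr // mul1r ler_nat.
have [M M0 [sM sM']] := @cvg_infty_dist _ _ _ _ _ sm sp eta0.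
(* The slope that carries distance [dl / 2] from a jump to distance [M] from the origin, where [s]
   is within [eta] of its limits. *)
pose la := 2 * M / dl.
have laE y : la * y = M * (y / (dl / 2)) by rewrite /la; field; lra.
pose g := (fun=> F (t 0%N)) +
  \sum_(i < n) (F (t i.+1) - F (t i)) *: (fun x => s (la * x + - la * t i.+1)).
exists g.
  apply: linspanD; first exact: linspan_cst sm sp (@nesym _ _ _ (elimN eqP (oner_neq0 R))).
  by apply: linspan_sum => i; apply/linspanZ/linspan_incl; exists la, (- la * t i.+1).
move=> x.
have t0K : t 0%N = - K by rewrite /t mul0r addr0.
have tnK : K <= t n by rewrite /t; lra.
have step := @step_function_dist R F t e n _ _ _ _ x.
pose ind (i : nat) : R := (t i.+1 <= x)%R%:R.
pose w (i : 'I_n) := `|ind i - s (la * x + - la * t i.+1)|.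
have wB : \sum_(i < n) w i <= (B + 1) + n%:R * eta.
  have wfar (i : 'I_n) : eta < w i -> `|x - t i.+1| < dl / 2.
    rewrite !ltNge; apply: contraNN => far.
    rewrite /w /ind (_ : la * x + _ = M * ((x - t i.+1) / (dl / 2))); last first.
      by rewrite -laE; ring.
    have dl20 : 0 < dl / 2 by rewrite divr_gt0.
    move: far; rewrite ler_normr => /orP[] far.
      have -> : t i.+1 <= x by rewrite -subr_ge0 (le_trans _ far) // ltW.
      rewrite distrC sM' // ler_pMr // ler_pdivlMr // mul1r //.
    have xt : x < t i.+1 by rewrite -subr_gt0 -opprB (lt_le_trans dl20).
    rewrite [t i.+1 <= x]leNgt xt /= distrC sM //.
    have : (x - t i.+1) / (dl / 2) <= -1.
      by rewrite ler_pdivrMr // mulN1r -lerN2 opprK.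
    by rewrite -[- M]mulrN1 ler_pM2l.
  apply: ler_sum_one_large.
  - exact: ltW.
  - by rewrite addr_ge0 // ltW.
  - move=> i; rewrite (le_trans (ler_normB _ _)) // addrC lerD //.
    by rewrite /ind; case: (t i.+1 <= x); rewrite ?normr1 ?normr0.
  (* Two sigmoids in transition at the same [x] have centres less than [dl] apart, while distinct
     grid points differ by at least [dl]. *)
  move=> i j /wfar xi /wfar xj; apply/val_inj/eqP => /=.
  have : `|t i.+1 - t j.+1| < dl.
    rewrite -(subrK x (t i.+1)) -addrA [dl]splitr (le_lt_trans (ler_normD _ _))//.
    by rewrite ltrD // distrC.
  have -> : t i.+1 - t j.+1 = (i%:R - j%:R) * dl by rewrite /t -!natr1; ring.
  rewrite normrM (gtr0_norm dl0) gtr_pMl // => ij.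
  have : (i < j.+1)%N && (j < i.+1)%N.
    rewrite -!(ltr_nat R) -!natr1; move: ij; rewrite ltr_norml; lra.
  by rewrite !ltnS -eqn_leq.
have FgE : F x - g x = (F x - (F (t 0%N) + \sum_(i < n) (F (t i.+1) - F (t i)) * ind i))
    + \sum_(i < n) (F (t i.+1) - F (t i)) * (ind i - s (la * x + - la * t i.+1)).
  rewrite /g [in LHS]fctE fct_sumE.
  rewrite (eq_bigr (fun i : 'I_n => (F (t i.+1) - F (t i)) * s (la * x + - la * t i.+1))) //.
  under [X in _ = _ + X]eq_bigr do rewrite mulrBr.
  rewrite sumrB; ring.
rewrite FgE (le_trans (ler_normD _ _)) //.
apply: (@le_trans _ _ (e + e * (B + 1 + n%:R * eta))).
  apply: lerD.
    apply: step.
    - by move=> i; rewrite tS lerDl ltW.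
    - by move=> y yt; apply: (@ler_dist_half _ _ _ lm); apply: FK; rewrite ?t0K //; lra.
    - by move=> i y /andP[ty]; rewrite tS => yt; apply: Fd; rewrite ger0_norm; lra.
    - by move=> y yt; apply: (@ler_dist_half _ _ _ lp); apply: FK' => //; lra.
  apply: le_trans (_ : e * \sum_(i < n) w i <= _); last by rewrite ler_pM2l.
  rewrite mulr_sumr (le_trans (ler_norm_sum _ _ _)) //; apply: ler_sum => i _.
  rewrite normrM ler_wpM2r //; apply: Fd.
  by rewrite tS addrC addKr gtr0_norm.
rewrite [leRHS](_ : _ = e * (B + 3)); last by rewrite /e divfK // gt_eqF // addr_gt0.
rewrite -[X in X + _]mulr1 -mulrDr ler_pM2l //; lra.
Qed.

(** An affine change of values turns [phi] into a sigmoid with limits 0 and 1; the constant this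
    introduces is in the span by [linspan_cst]. *)
Lemma affine_dilates_approx (R : realType) (phi F : R -> R) (lm lp a b : R) :
  continuous phi -> phi x @[x --> -oo] --> lm -> phi x @[x --> +oo] --> lp ->
  lm <> lp ->
  continuous F -> F x @[x --> -oo] --> a -> F x @[x --> +oo] --> b ->
  span_approx (affine_dilates phi) F.
Proof.
move=> cp pm pp lml cF Fa Fb.
have l0 : lp - lm != 0 by rewrite subr_eq0; apply/eqP/nesym.
pose s x := (phi x - lm) / (lp - lm).
have cs : continuous s.
  by move=> x; apply: cvgM (cvg_cst _); apply: cvgB (cvg_cst _); exact: cp.
have sm : s x @[x --> -oo] --> (0 : R).
  rewrite -(mul0r (lp - lm)^-1) -(subrr lm).
  by apply: cvgM (cvg_cst _); apply: cvgB (cvg_cst _); exact: pm.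
have sp : s x @[x --> +oo] --> (1 : R).
  rewrite -(divff l0).
  by apply: cvgM (cvg_cst _); apply: cvgB (cvg_cst _); exact: pp.
move=> e e0; have [g [k [c [u [su ->]]]] Fg] := @sigmoid_approx _ _ _ _ _ cs sm sp cF Fa Fb _ e0.
exists (\sum_(i < k) c i *: u i) => //.
apply: linspan_sum => i; apply: linspanZ.
have [p [q ->]] := su i.
have -> : (fun x => s (p * x + q)) =
    (lp - lm)^-1 *: ((fun x => phi (p * x + q)) + (fun=> - lm)).
  by apply/funext => x; exact: mulrC.
apply/linspanZ/linspanD; last exact: linspan_cst pm pp lml.
by apply: linspan_incl; exists p, q.
Qed.

(** * Layers of a network on row vectors *)

Definition ridges {R : realType} (phi : R -> R) (n : nat) :
    set ('rV[R]_n -> R) :=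
  [set u | exists (a : 'rV[R]_n) (b : R), u = fun x => phi (dotp a x + b)].

Definition hidden2 {R : realType} (phi : R -> R) (n : nat) :
    set ('rV[R]_n -> R) :=
  [set u | exists (f : 'rV[R]_n -> R) (b : R),
     linspan (ridges phi n) f /\ u = fun x => phi (f x + b)].

Lemma span_approx_closure (R : realType) (T : choiceType) (A : set (T -> R))
    (f : T -> R) :
  span_approx A f -> uniform_closure (linspan A) f.
Proof.
move=> Af P /uniform_nbhs [E [entE EP]].
move: entE; rewrite -entourage_from_ballE => -[e /= e0 eE].
have e20 : 0 < e / 2 by rewrite divr_gt0.
have [g Ag fg] := Af _ e20.
exists g; split=> //; apply: EP => y _; apply: eE => /=.
by rewrite /ball /= (le_lt_trans (fg y)) // ltr_pdivrMr // ltr_pMr // ltr1n.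
Qed.

Lemma span_approx_coord (R : realType) (phi F : R -> R) (n : nat) (i : 'I_n) :
  span_approx (affine_dilates phi) F ->
  span_approx (ridges phi n) (fun v => F (v ord0 i)).
Proof.
move=> AF e e0; have [g Ag Fg] := AF _ e0.
exists (g \o (fun v : 'rV[R]_n => v ord0 i)); last by move=> v; apply: Fg.
apply: linspan_comp Ag => u [a [b ->]]; apply: linspan_incl.
exists (a *: delta_mx ord0 i), b.
by apply/funext => v /=; rewrite dotpZl dotp_delta.
Qed.

(** The approximation of [q] holds on the whole line, hence at any value of the inner network;
    uniform continuity of [q] absorbs the error made on [G]. *)
Lemma span_approx_layer (R : realType) (phi q : R -> R) (lm lp a b : R)
    (n : nat) (G : 'rV[R]_n -> R) :
  continuous phi -> phi x @[x --> -oo] --> lm -> phi x @[x --> +oo] --> lp ->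
  lm <> lp ->
  continuous q -> q x @[x --> -oo] --> a -> q x @[x --> +oo] --> b ->
  span_approx (ridges phi n) G ->
  span_approx (hidden2 phi n) (q \o G).
Proof.
move=> cp pm pp lml cq qa qb AG e e0; have e20 : 0 < e / 2 by rewrite divr_gt0.
have [g Ag qg] := @affine_dilates_approx _ _ _ _ _ _ _ cp pm pp lml cq qa qb _ e20.
have [d d0 qd] := @cvg_infty_unif_cont _ _ _ _ _ cq qa qb e20.
have d20 : 0 < d / 2 by rewrite divr_gt0.
have [G' AG' GG'] := AG _ d20.
exists (g \o G').
  apply: linspan_comp Ag => u [c [l ->]]; apply: linspan_incl.
  (* The outer weight [c] is absorbed into the first-layer function, since spans are closed under
     scaling. *)
  by exists (c *: G'), l; split=> //; exact: linspanZ.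
move=> v /=; rewrite -(subrK (q (G' v)) (q (G v))) -addrA [e]splitr.
rewrite (le_trans (ler_normD _ _)) // lerD // qd // (le_lt_trans (GG' v)) //.
by rewrite ltr_pdivrMr // ltr_pMr // ltr1n.
Qed.

Lemma cvg_pinfty_eventually (R : realType) (F : R -> R) (M l : R) :
  (forall x, M <= x -> F x = l) -> F x @[x --> +oo] --> l.
Proof.
move=> Fl; apply/cvgrPdist_le => e e0; exists M; split=> [|x Mx]; first exact: num_real.
by rewrite Fl ?subrr ?normr0 ltW.
Qed.

Lemma cvg_ninfty_eventually (R : realType) (F : R -> R) (M l : R) :
  (forall x, x <= M -> F x = l) -> F x @[x --> -oo] --> l.
Proof.
move=> Fl; apply/cvgrPdist_le => e e0; exists M; split=> [|x Mx]; first exact: num_real.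
by rewrite Fl ?subrr ?normr0 ltW.
Qed.

(* Polarization, with the square truncated so that it has limits at infinity. *)
Lemma span_approx_mul (R : realType) (phi : R -> R) (lm lp M : R) (n : nat)
    (F G : 'rV[R]_n -> R) :
  continuous phi -> phi x @[x --> -oo] --> lm -> phi x @[x --> +oo] --> lp ->
  lm <> lp ->
  (forall v, `|F v| <= M) -> (forall v, `|G v| <= M) ->
  span_approx (ridges phi n) F -> span_approx (ridges phi n) G ->
  span_approx (hidden2 phi n) (fun v => F v * G v).
Proof.
move=> cp pm pp lml FM GM AF AG.
(* [L] bounds both the sum and the difference of [F] and [G], so the truncation at [L ^+ 2] does not
   alter their squares. *)
pose L := `|M| + `|M|; have L0 : 0 <= L by rewrite addr_ge0.
pose q : R -> R := (fun t => t ^+ 2) \min (fun=> L ^+ 2).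
have cq : continuous q.
  move=> x; apply: continuous_min; last exact: cvg_cst.
  exact: exprn_continuous.
have qL x : L <= `|x| -> q x = L ^+ 2.
  move=> Lx; apply/min_idPr; rewrite -[leRHS]real_normK ?num_real //.
  by rewrite ler_sqr ?nnegrE.
have qm : q x @[x --> -oo] --> L ^+ 2.
  apply: (@cvg_ninfty_eventually _ _ (- L)) => x xL; apply: qL.
  by rewrite -normrN (le_trans _ (ler_norm _)) // lerNr.
have qp : q x @[x --> +oo] --> L ^+ 2.
  apply: (@cvg_pinfty_eventually _ _ L) => x xL; apply: qL.
  by rewrite (le_trans _ (ler_norm _)).
have qE x y : `|x| <= M -> `|y| <= M -> q (x + y) = (x + y) ^+ 2.
  move=> xM yM; apply/min_idPl; rewrite -[leLHS]real_normK ?num_real //.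
  rewrite ler_sqr ?nnegrE // (le_trans (ler_normD _ _)) //.
  by rewrite lerD // (le_trans _ (ler_norm _)).
have AB : span_approx (ridges phi n) (F + -1 *: G).
  by apply: span_approxD => //; exact: span_approxZ.
have AFG : span_approx (ridges phi n) (F + G) by exact: span_approxD.
have layer H := @span_approx_layer _ _ _ _ _ _ _ n H cp pm pp lml cq qm qp.
have : span_approx (hidden2 phi n)
    (4^-1 *: (q \o (F + G)) + (- 4^-1) *: (q \o (F + -1 *: G))).
  by apply: span_approxD; apply: span_approxZ; exact: layer.
congr span_approx; apply/funext => v.
rewrite -[LHS]/(4^-1 * q (F v + G v) + - 4^-1 * q (F v + -1 * G v)).
by rewrite mulN1r !qE ?normrN //; field.
Qed.

(** * Shallow networks along opposite rays *)

Lemma cvg_antipodal (R : realType) (phi : R -> R) (lm lp z b : R) :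
  phi x @[x --> -oo] --> lm -> phi x @[x --> +oo] --> lp ->
  phi (t * z + b) + phi (- t * z + b) @[t --> +oo] -->
    (if z == 0 then phi b + phi b else lm + lp).
Proof.
move=> pm pp.
(* The two arguments run to opposite infinities, so each limit occurs once; a negative [z] only
   swaps the summands. *)
have pos y : 0 < y -> phi (t * y + b) + phi (- t * y + b) @[t --> +oo] --> lm + lp.
  move=> y0.
  have up c : t * y + c @[t --> +oo] --> +oo.
    apply: cvg_comp (cvg_addrr c); exact: gt0_cvgMly.
  rewrite addrC; apply: cvgD; first exact: cvg_comp (up b) pp.
  have /cvg_comp/(_ ((cvgNy_compNP _ _).1 pm)) := up (- b).
  apply: cvg_trans; apply: near_eq_cvg; near=> t => /=; congr phi; ring.
have [->|z0] := eqVneq z 0.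
  by under eq_fun do rewrite !mulr0 !add0r; exact: cvg_cst.
have [/pos//|zle] := ltP 0 z.
have : 0 < - z by rewrite oppr_gt0 lt_neqAle z0.
move=> /pos; rewrite (_ : (fun t => _) = (fun t => phi (t * z + b) + phi (- t * z + b))) //.
by apply/funext => t; rewrite mulrN mulrNN mulNr addrC.
Unshelve. all: by end_near. Qed.

Definition row2 {R : realType} (x y : R) : 'rV[R]_2 :=
  \row_j (if j == ord0 then x else y).

Lemma dotp_row2 (R : realType) (a : 'rV[R]_2) (x y : R) :
  dotp a (row2 x y) = a ord0 ord0 * x + a ord0 ord_max * y.
Proof.
rewrite /dotp big_ord_recl big_ord1 !mxE /=; congr (_ + a _ _ * _).
exact: val_inj.
Qed.

(** Taking [m] larger than every ratio of weight coordinates ensures that no nonzero weight is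
    orthogonal to [row2 1 y]. Whether a unit stays constant along the ray then depends on its weight
    alone, so [C] does not involve [y]. *)
Lemma N1_antipodal (R : realType) (phi : R -> R) (lm lp : R)
    (g : 'rV[R]_2 -> R) :
  phi x @[x --> -oo] --> lm -> phi x @[x --> +oo] --> lp -> N1 phi g ->
  exists (m C : R), 1 <= m /\ forall y, `|y| = m ->
    g (t *: row2 1 y) + g (- t *: row2 1 y) @[t --> +oo] --> C.
Proof.
move=> pm pp [k [c [s [As ->]]]].
have [a /choice [b sE]] := choice As.
(* A nonzero [a] is not orthogonal to [(1, y)] once [|y| > |a_0 / a_1|];
   if [a_1 = 0], then [r] is the junk value 0 and any [y] will do. *)
pose r i := `|a i ord0 ord0 / a i ord0 ord_max|.
exists (1 + \sum_(i < k) r i),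
  (\sum_(i < k) c i * (if a i == 0 then phi (b i) + phi (b i) else lm + lp)).
have r0 i : 0 <= r i by exact: normr_ge0.
split=> [|y ym]; first by rewrite lerDl sumr_ge0.
have az i : (dotp (a i) (row2 1 y) == 0) = (a i == 0).
  rewrite dotp_row2 mulr1; apply/idP/eqP => [|->]; last by rewrite !mxE mul0r addr0.
  have [a1 /eqP|a1] := eqVneq (a i ord0 ord_max) 0.
    rewrite a1 mul0r addr0 => a0; apply/rowP => j; rewrite !mxE.
    have [->//|j0] := eqVneq j ord0.
    by rewrite -[RHS]a1; congr (a i _ _); apply: val_inj; case: j j0 => [[|[]]].
  rewrite addr_eq0 => /eqP a0; exfalso.
  (* Orthogonality forces [r i] to equal [m], which is at least [1 + r i]. *)
  have : r i = `|y| by rewrite /r a0 mulrC -mulrN mulKf // normrN.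
  rewrite ym (bigD1 i) //= => /eqP; rewrite addrCA -subr_eq0 opprD addrA subrr.
  rewrite add0r oppr_eq0 paddr_eq0 ?oner_eq0 // sumr_ge0 //.
under eq_fun do rewrite !fct_sumE -big_split.
apply: cvg_big => [|i _]; first exact: add_continuous.
rewrite -az (_ : (fun t => _) = (fun t => c i * (phi (t * dotp (a i) (row2 1 y) + b i)
  + phi (- t * dotp (a i) (row2 1 y) + b i)))).
  apply: cvgM; [exact: cvg_cst|exact: cvg_antipodal].
apply/funext => t; rewrite mulrDr -!dotpZr -[LHS]/(c i * _ + c i * _).
by rewrite sE.
Qed.


Theorem theorem5p10 (R : realType) (phi : R -> R) (lm lp : R)
  (phi_cont : continuous phi)
  (phi_ninfty : phi x @[x --> -oo] --> lm)
  (phi_pinfty : phi x @[x --> +oo] --> lp)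
  (lm_neq_lp : lm <> lp)
  (h : R -> R)
  (h_cont : continuous h)
  (h0 : forall x : R, x <= 0 -> h x = 0)
  (h1 : forall x : R, 1 <= x -> h x = 1) :
  let f : 'rV[R]_2 -> R := fun v => h (v ord0 ord0) * h (v ord0 ord_max) in
  uniform_closure (@N2 R phi 2) f /\
  forall g : 'rV[R]_2 -> R, @N1 R phi 2 g ->
    ((4^-1)%:E <= ereal_sup [set (`|f v - g v|)%:E | v in [set: 'rV[R]_2]])%E.
Proof.
move=> f; split.
  have hm := @cvg_ninfty_eventually _ h 0 0 h0.
  have hp := @cvg_pinfty_eventually _ h 1 1 h1.
  have [M _ hM] := @cvg_infty_bounded _ _ _ _ h_cont hm hp.
  have Ah := @affine_dilates_approx _ _ _ _ _ _ _ phi_cont phi_ninfty phi_pinfty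
    lm_neq_lp h_cont hm hp.
  apply: (@span_approx_closure _ _ (hidden2 phi 2)).
  apply: (@span_approx_mul _ _ _ _ M _ _ _ phi_cont phi_ninfty phi_pinfty lm_neq_lp);
    by [move=> v; exact: hM|exact: span_approx_coord].
move=> g Ng; rewrite leNgt; apply/negP => sup_lt.
(* A supremum below 1/4 is a real number: it is not [-oo], because the value at [v = 0] lies below
   it. *)
have [s s4 fg] : exists2 s : R, s < 4^-1 & forall v, `|f v - g v| <= s.
  have ub v : ((`|f v - g v|)%:E <=
      ereal_sup [set (`|f v - g v|)%:E | v in [set: 'rV[R]_2]])%E.
    by apply: ereal_sup_ubound; exists v.
  move: sup_lt ub; case: (ereal_sup _) => [s|//|_ /(_ 0)//].
  by rewrite lte_fin => s4 ub; exists s => // v; have := ub v; rewrite lee_fin.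
have [m [C [m1 gC]]] := @N1_antipodal _ _ _ _ _ phi_ninfty phi_pinfty Ng.
(* This tolerance yields the contradiction: the two antipodal sums of [f] differ by 1, but the four
   errors and the two limits allow at most [4 * s + 2 * (4^-1 - s)], which is below 1. *)
have e0 : 0 < 4^-1 - s by rewrite subr_gt0.
have m0 : 0 <= m by rewrite (le_trans ler01).
have [T T0 gT] := @cvg_pinfty_dist _ _ _ _ (gC m (ger0_norm m0)) e0.
have [T' T'0 gT'] := @cvg_pinfty_dist _ _ _ _ (gC (- m) (etrans (normrN m) (ger0_norm m0))) e0.
(* Besides passing both thresholds, [t >= 1] and [t * m >= 1] put all coordinates where [h] is
   constant; of the four points only [t *: row2 1 m] has no negative coordinate. *)
pose t := T + T' + 1.
have fE c y : f (c *: row2 1 y) = h c * h (c * y).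
  by rewrite /f !mxE /= mulr1.
have t1 : 1 <= t by rewrite /t; lra.
have tm : 1 <= t * m by rewrite mulr_ege1.
have f1 : f (t *: row2 1 m) = 1 by rewrite fE !h1 // mulr1.
have f2 : f (- t *: row2 1 m) = 0 by rewrite fE h0 ?mul0r //; lra.
have f3 : f (t *: row2 1 (- m)) = 0 by rewrite fE (h0 (t * - m)) ?mulr0 // mulrN; lra.
have f4 : f (- t *: row2 1 (- m)) = 0 by rewrite fE h0 ?mul0r //; lra.
have := fg (t *: row2 1 m); have := fg (- t *: row2 1 m).
have := fg (t *: row2 1 (- m)); have := fg (- t *: row2 1 (- m)).
have /gT : T <= t by rewrite /t; lra.
have /gT' : T' <= t by rewrite /t; lra.
rewrite f1 f2 f3 f4 !ler_norml; lra.
Qed.
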